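(* As $n\to\infty$, $k(n)=\sqrt{n}\,(1+o(1))$.
   Context: A system on $n$ elements is a triple $(\mathcal{F},w,s)$ where $\mathcal{F}=(F_1,\dots,F_m)$ is a collection of subsets of $[n]=\{1,\dots,n\}$, $w\in[0,1]^m$ with $\sum_i w_i=1$, and $s\in[0,1]^{m\times m\times n}$ with $\sum_p s_{ijp}=1$ for all $i,j\in[m]$. It is intersecting if for all $i,j\in[m]$, $p\in[n]$: $s_{ijp}>0$ implies $p\in F_i\cap F_j$. It is balanced if for all $p\in[n]$, $\sum_{i=1}^m\sum_{j=1}^m w_iw_js_{ijp}=1/n$. Its cardinality is the size of the largest set in $\mathcal{F}$. $k(n)$ is the minimum $k$ such that there exists a balanced intersecting system on $n$ elements with cardinality $k$. *)

(* Defs.v *)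
From HB Require Import structures.
From mathcomp Require Import all_boot all_order all_algebra.
From mathcomp Require Import all_classical all_reals all_analysis.
Set Implicit Arguments. Unset Strict Implicit. Unset Printing Implicit Defensive.
Import Order.TTheory GRing.Theory Num.Theory.
Local Open Scope ring_scope.

Definition is_system (R : realType) (n m : nat) (F : 'I_m -> {set 'I_n})
  (w : 'I_m -> R) (s : 'I_m -> 'I_m -> 'I_n -> R) : Prop :=
  (forall i, 0 <= w i <= 1) /\ (\sum_(i < m) w i = 1) /\
  (forall i j p, 0 <= s i j p <= 1) /\
  (forall i j, \sum_(p < n) s i j p = 1).

Definition intersecting (R : realType) (n m : nat) (F : 'I_m -> {set 'I_n})
  (s : 'I_m -> 'I_m -> 'I_n -> R) : Prop :=
  forall i j p, 0 < s i j p -> p \in F i :&: F j.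

Definition balanced (R : realType) (n m : nat)
  (w : 'I_m -> R) (s : 'I_m -> 'I_m -> 'I_n -> R) : Prop :=
  forall p : 'I_n,
    \sum_(i < m) \sum_(j < m) w i * w j * s i j p = 1 / n%:R.

Definition cardinality (n m : nat) (F : 'I_m -> {set 'I_n}) : nat :=
  \max_(i < m) #|F i|.

Definition has_bis (R : realType) (n k : nat) : Prop :=
  exists (m : nat) (F : 'I_m -> {set 'I_n}) (w : 'I_m -> R)
         (s : 'I_m -> 'I_m -> 'I_n -> R),
    is_system F w s /\ intersecting F s /\ balanced w s /\ cardinality F = k.

Lemma has_bis_ex_bool (R : realType) (n : nat) :
  (exists k, has_bis R n k) -> exists k, `[< has_bis R n k >].
Proof. by case=> k hk; exists k; apply/asboolP. Qed.

(* k(n): the minimum k such that a balanced intersecting system on n elements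
   with cardinality k exists (defaults to 0 if there is none, e.g. n = 0). *)
Definition kfun (R : realType) (n : nat) : nat :=
  match pselect (exists k, has_bis R n k) with
  | left h => ex_minn (has_bis_ex_bool h)
  | right _ => 0%N
  end.

(* Main.v *)
Require Import Defs.
From HB Require Import structures.
From mathcomp Require Import all_boot all_order all_algebra.
From mathcomp Require Import all_field.
From mathcomp Require Import all_classical all_reals all_analysis.
From mathcomp Require Import ring lra zify.
Import Order.TTheory GRing.Theory Num.Theory numFieldNormedType.Exports.

(** Lower bound: if [x p] is the total weight of the sets containing [p], then
    balance and intersection give [1 / n <= x p ^ 2], while [\sum_p x p] is the
    mean size of a set; hence [sqrt n <= k].

    Upper bound: products of systems give [k (n m) <= k n * k m] and disjoint
    unions give [k (n + m) <= k n + k m].  The non-vertical lines of the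
    projective plane of order [q] give [k (q (q + 1)) <= q + 1], and grids give
    [k r <= 4 sqrt r].  To avoid any result on prime gaps, multiply the systems
    of orders [2 ^ j] and [3 ^ l]: as the ratios [2 ^ a / 3 ^ b] come arbitrarily
    close to [1], the numbers [2 ^ j * 3 ^ l] with [j], [l] large have
    consecutive ratios tending to [1].  So [n = N + r], where [N] comes from such
    a product and [r = o(n)] is absorbed by a disjoint union. *)

Set Implicit Arguments. Unset Strict Implicit. Unset Printing Implicit Defensive.
Local Open Scope ring_scope.

(** * Systems over finite types, their products and disjoint unions *)

(* Index and ground sets are arbitrary finite types, so that products and
   disjoint unions need no renumbering. *)
Definition bis_on (R : realType) (T : finType) (k : nat) : Prop :=
  exists (I : finType) (F : I -> {set T}) (w : I -> R) (s : I -> I -> T -> R),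
  [/\ (forall i, 0 <= w i) /\ \sum_i w i = 1,
      (forall i j p, 0 <= s i j p) /\ (forall i j, \sum_p s i j p = 1),
      forall i j p, 0 < s i j p -> p \in F i :&: F j,
      forall p, \sum_i \sum_j w i * w j * s i j p = #|T|%:R^-1
    & forall i, (#|F i| <= k)%N].

Definition bis_le (R : realType) (n k : nat) : Prop :=
  exists2 T : finType, #|T| = n & bis_on R T k.

(** Recovers the upper bounds by 1 in [is_system], which [bis_on] leaves implicit in the sums. *)
Lemma le_sum1 (R : realType) (I : finType) (f : I -> R) (i : I) :
  (forall i, 0 <= f i) -> \sum_i f i = 1 -> f i <= 1.
Proof.
move=> f0 <-; rewrite (bigD1 i) //= lerDl.
exact: sumr_ge0.
Qed.

Lemma sum_pair_mul (R : pzSemiRingType) (A B : finType) (f : A -> R) (g : B -> R) :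
  \sum_(x : A * B) f x.1 * g x.2 = (\sum_a f a) * (\sum_b g b).
Proof.
rewrite -(pair_bigA _ (fun a b => f a * g b)) /= mulr_suml.
by apply: eq_bigr => a _; rewrite mulr_sumr.
Qed.

(** [bis_on] only bounds the sizes of the sets, so the exact cardinality may come out smaller than
    [k]. *)
Lemma has_bis_of_le (R : realType) (n k : nat) :
  bis_le R n k -> exists2 k', has_bis R n k' & (k' <= k)%N.
Proof.
case=> T <- [I [F [w [s [[w0 w1] [s0 s1] sF sb Fk]]]]].
pose F' (i : 'I_#|I|) : {set 'I_#|T|} :=
  [set p | enum_val p \in F (enum_val i)].
pose w' (i : 'I_#|I|) := w (enum_val i).
pose s' (i j : 'I_#|I|) (p : 'I_#|T|) :=
  s (enum_val i) (enum_val j) (enum_val p).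
have sumI (f : I -> R) : \sum_(i < #|I|) f (enum_val i) = \sum_i f i.
  by rewrite -big_enum_val.
have sumT (f : T -> R) : \sum_(i < #|T|) f (enum_val i) = \sum_i f i.
  by rewrite -big_enum_val.
have Fle : (cardinality F' <= k)%N.
  apply/bigmax_leqP => i _; apply: leq_trans (Fk (enum_val i)).
  rewrite -(card_imset _ enum_val_inj) subset_leq_card //.
  by apply/fintype.subsetP => _ /imsetP[p + ->]; rewrite inE.
exists (cardinality F') => //.
exists #|I|, F', w', s'.
  split; last split; last split=> //.
  - split=> [i|]; first by rewrite w0 (le_sum1 _ w0).
    split; first by rewrite sumI.
    split=> [i j p|i j]; last by rewrite sumT.
    by rewrite s0 (le_sum1 _ (s0 _ _)).
  - by move=> i j p /sF; rewrite !inE.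
  - move=> p; rewrite /w' /s' -[RHS]/(1 / _) div1r -(sb (enum_val p)) -sumI.
    by apply: eq_bigr => i _; rewrite -sumI.
Qed.

Lemma kfun_le (R : realType) (n k : nat) : bis_le R n k -> (kfun R n <= k)%N.
Proof.
move=> /has_bis_of_le[k' hk' k'k]; rewrite /kfun.
case: pselect => [h|//]; case: ex_minnP => m _ min.
by apply: leq_trans k'k; apply/min/asboolP.
Qed.

Lemma bis_leW (R : realType) (n k l : nat) :
  (k <= l)%N -> bis_le R n k -> bis_le R n l.
Proof.
move=> kl [T Tn [I [F [w [s [? ? ? ? Fk]]]]]]; exists T => //.
exists I, F, w, s; split=> // i; exact: leq_trans (Fk i) kl.
Qed.

(** Weights and shares multiply coordinatewise, so every sum factors by [sum_pair_mul]; a positive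
    product share forces both factors to be positive. *)
Lemma bis_le_mul (R : realType) (n m k l : nat) :
  bis_le R n k -> bis_le R m l -> bis_le R (n * m) (k * l).
Proof.
case=> T <- [I [F [w [s [[w0 w1] [s0 s1] sF sb Fk]]]]].
case=> U <- [J [G [v [t [[v0 v1] [t0 t1] tG tb Gl]]]]].
exists (T * U)%type; first by rewrite card_prod.
exists (I * J)%type, (fun a => finset.setX (F a.1) (G a.2)),
  (fun a => w a.1 * v a.2),
  (fun a b p => s a.1 b.1 p.1 * t a.2 b.2 p.2).
split.
- by split=> [a|]; rewrite ?mulr_ge0 // sum_pair_mul w1 v1 mulr1.
- by split=> [a b p|a b]; rewrite ?mulr_ge0 // sum_pair_mul s1 t1 mulr1.
- move=> [i a] [j b] [p q] /= h.
  have sp : 0 < s i j p.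
    by rewrite lt0r s0 andbT; apply: contraTneq h => ->; rewrite mul0r ltxx.
  have tp : 0 < t a b q.
    by rewrite lt0r t0 andbT; apply: contraTneq h => ->; rewrite mulr0 ltxx.
  have := sF _ _ _ sp; have := tG _ _ _ tp.
  by rewrite !inE /= => /andP[-> ->] /andP[-> ->].
- move=> [p q] /=.
  rewrite card_prod natrM invfM -(sb p) -(tb q) -sum_pair_mul; apply: eq_bigr => a _.
  by rewrite -sum_pair_mul; apply: eq_bigr => b _; ring.
- by move=> a; rewrite finset.cardsX leq_mul.
Qed.

(** The sets are all unions of some [F i] with some [G j]. Each pair puts a fraction [n / (n + m)]
    of its share on the left part, following [s], and the rest on the right, following [t]; a left
    point then gets [n / (n + m)] times [1 / n]. *)
Lemma bis_le_add (R : realType) (n m k l : nat) : (0 < n + m)%N ->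
  bis_le R n k -> bis_le R m l -> bis_le R (n + m) (k + l).
Proof.
move=> nm0 [T Tn [I [F [w [s [[w0 w1] [s0 s1] sF sb Fk]]]]]].
case=> U Um [J [G [v [t [[v0 v1] [t0 t1] tG tb Gl]]]]].
exists (T + U)%type; first by rewrite card_sum Tn Um.
pose c : R := n%:R / (n + m)%:R; pose d : R := m%:R / (n + m)%:R.
have c0 : 0 <= c by rewrite divr_ge0.
have d0 : 0 <= d by rewrite divr_ge0.
have cd : c + d = 1 by rewrite -mulrDl -natrD divff // pnatr_eq0 -lt0n.
exists (I * J)%type,
  (fun a => [set p : T + U |
     match p with inl x => x \in F a.1 | inr y => y \in G a.2 end]%SET),
  (fun a => w a.1 * v a.2),
  (fun a b (p : T + U) => match p with
     inl x => c * s a.1 b.1 x | inr y => d * t a.2 b.2 y end).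
split.
- by split=> [a|]; rewrite ?mulr_ge0 // sum_pair_mul w1 v1 mulr1.
- split=> [a b [p|q]|a b]; rewrite ?mulr_ge0 // big_sumType /= -!mulr_sumr.
  by rewrite s1 t1 !mulr1.
- move=> [i a] [j b] [p|q] /= h.
    have sp : 0 < s i j p.
      by rewrite lt0r s0 andbT; apply: contraTneq h => ->; rewrite mulr0 ltxx.
    by have := sF _ _ _ sp; rewrite !inE.
  have tp : 0 < t a b q.
    by rewrite lt0r t0 andbT; apply: contraTneq h => ->; rewrite mulr0 ltxx.
  by have := tG _ _ _ tp; rewrite !inE.
- have E : #|{: T + U}| = (n + m)%N by rewrite card_sum Tn Um.
  rewrite E; case=> [p|q].
    have n0 : (0 < n)%N by rewrite -Tn; apply/card_gt0P; exists p.
    (* The [J] components are summed out, as [v] has total 1; what remains is [c] times the balance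
       sum of the first system. *)
    transitivity (\sum_(a : I * J) (\sum_i w a.1 * w i * s a.1 i p) * (c * v a.2)).
      apply: eq_bigr => a _.
      transitivity (\sum_(b : I * J) (w a.1 * w b.1 * s a.1 b.1 p) * (c * v a.2 * v b.2)).
        by apply: eq_bigr => b _; ring.
      by rewrite (sum_pair_mul (fun i => w a.1 * w i * s a.1 i p)
        (fun j => c * v a.2 * v j)) -mulr_sumr v1 mulr1.
    rewrite (sum_pair_mul (fun h => \sum_i w h * w i * s h i p)
        (fun j => c * v j)) -mulr_sumr v1 sb Tn mulr1.
    by rewrite /c mulrA mulVf ?mul1r // pnatr_eq0 -lt0n.
  have m0 : (0 < m)%N by rewrite -Um; apply/card_gt0P; exists q.
  transitivity (\sum_(a : I * J) (d * w a.1) * (\sum_j v a.2 * v j * t a.2 j q)).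
    apply: eq_bigr => a _.
    transitivity (\sum_(b : I * J) (d * w a.1 * w b.1) * (v a.2 * v b.2 * t a.2 b.2 q)).
      by apply: eq_bigr => b _; ring.
    by rewrite (sum_pair_mul (fun i => d * w a.1 * w i)
        (fun j => v a.2 * v j * t a.2 j q)) -mulr_sumr w1 mulr1.
  rewrite (sum_pair_mul (fun i => d * w i)
        (fun h => \sum_j v h * v j * t h j q)) -mulr_sumr w1 tb Um mulr1.
  by rewrite /d mulrC mulrA mulVf ?mul1r // pnatr_eq0 -lt0n.
- move=> a.
  rewrite (_ : [set p | _]%SET = ((@inl T U @: F a.1) :|: (@inr T U @: G a.2))%SET); last first.
    apply/finset.setP => -[x|y]; rewrite !inE.
      rewrite mem_imset; last by move=> ? ? [].
      by rewrite [X in _ || X](_ : _ = false) ?orbF //; apply/negP => /imsetP[].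
    rewrite [X in X || _](_ : _ = false) /=; last by apply/negP => /imsetP[].
    by rewrite mem_imset // => ? ? [].
  apply: leq_trans (leq_card_setU _ _) _; apply: leq_add.
    exact: leq_trans (leq_imset_card _ _) (Fk _).
  exact: leq_trans (leq_imset_card _ _) (Gl _).
Qed.

Lemma bis_le_trivial (R : realType) (n : nat) : (0 < n)%N -> bis_le R n n.
Proof.
move=> n0; exists 'I_n; first by rewrite card_ord.
exists unit, (fun _ => finset.setT), (fun _ => 1), (fun _ _ _ => n%:R^-1); split.
- by split=> //; rewrite big_const card_unit /= addr0.
- split=> [*|_ _]; first by rewrite invr_ge0.
  by rewrite sumr_const card_ord -[LHS]mulr_natl divff // pnatr_eq0 -lt0n.
- by move=> *; rewrite !inE.
- by move=> p; rewrite !big_const card_unit /= !addr0 !mul1r card_ord.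
- by move=> _; rewrite cardsT card_ord.
Qed.

(** * Density of the products of two powers on the multiplicative scale *)

Lemma expr_unbounded (R : archiRealFieldType) (rho y : R) :
  1 < rho -> exists n, y < rho ^+ n.
Proof.
move=> rho1; have [n yn] : exists n, y < 1 + n%:R * (rho - 1).
  have d0 : 0 < rho - 1 by rewrite subr_gt0.
  exists (Num.bound `|(y - 1) / (rho - 1)|).
  rewrite -ltrBlDl -ltr_pdivrMr //.
  apply: le_lt_trans (ler_norm _) _.
  exact: (archi_boundP (normr_ge0 _)).
(* Bernoulli's inequality, by induction. *)
exists n; apply: lt_le_trans yn _; elim: n => [|n IH];
  first by rewrite mul0r addr0 expr0.
rewrite exprS -(@natr1 _ n); have n0 : 0 <= n%:R :> R by [].
set P := rho ^+ n in IH *; set k := n%:R in IH n0 *.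
have : rho * (1 + k * (rho - 1)) <= rho * P by rewrite ler_pM2l //; lra.
have : 0 <= k * (rho - 1) ^+ 2 by rewrite mulr_ge0 ?sqr_ge0.
nra.
Qed.

Lemma exists_trunc_log (R : archiRealFieldType) (rho y : R) :
  1 < rho -> 1 <= y -> exists n, rho ^+ n <= y < rho ^+ n.+1.
Proof.
move=> rho1 y1; have ex := expr_unbounded y rho1.
case: (ex_minnP ex) => -[|n] yn min.
  by move: yn; rewrite expr0 ltNge y1.
exists n; rewrite yn andbT leNgt; apply/negP => /min; by rewrite ltnn.
Qed.

(* Multiplying [p ^ j * q ^ l] by [rho = p ^ a / q ^ b] moves it up by less than
   a factor [1 + d] while keeping it of the same form. *)
Lemma dense_of_ratio (R : archiRealFieldType) (p q d : R) (a b M : nat) :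
  1 < p -> 1 < q -> 1 < p ^+ a / q ^+ b < 1 + d ->
  exists X : R, forall x, X <= x -> exists j l : nat,
  [/\ (M <= j)%N, (M <= l)%N
    & p ^+ j * q ^+ l <= x < (1 + d) * (p ^+ j * q ^+ l)].
Proof.
move=> p1 q1; set rho := _ / _ => /andP[rho1 rhod].
have [t pt] := expr_unbounded p rho1.
have p0 n : 0 < p ^+ n by rewrite exprn_gt0 // (lt_trans ltr01).
have q0 n : 0 < q ^+ n by rewrite exprn_gt0 // (lt_trans ltr01).
have r0 n : 0 < rho ^+ n by rewrite exprn_gt0 // (lt_trans ltr01).
(* The exponent [b * t + M] pays for up to [t] multiplications by [rho], each costing [q ^ b], and
   still leaves [q ^ M]. *)
pose X := p ^+ M * q ^+ (b * t + M).
have X0 : 0 < X by rewrite mulr_gt0.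
exists X => x Xx.
have [|j /andP[jl ju]] := @exists_trunc_log _ p (x / X) p1.
  by rewrite ler_pdivlMr // mul1r.
pose Y := p ^+ j * X; have Y0 : 0 < Y by rewrite mulr_gt0.
have Yx : Y <= x by rewrite -ler_pdivlMr.
have [|i /andP[il iu]] := @exists_trunc_log _ rho (x / Y) rho1.
  by rewrite ler_pdivlMr // mul1r.
(* Otherwise [p < rho ^ t <= rho ^ i <= x / Y], against [x < p ^ j.+1 * X = p * Y]. *)
have it : (i < t)%N.
  rewrite ltnNge; apply/negP => ti.
  have ri : rho ^+ t <= rho ^+ i by rewrite ler_weXn2l // ltW.
  have := lt_le_trans pt (le_trans ri il).
  move: ju; rewrite exprS !ltr_pdivrMr // ltr_pdivlMr // -mulrA => xu xl.
  by have := lt_trans xl xu; rewrite ltxx.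
exists (j + M + a * i)%N, (b * (t - i) + M)%N.
have E : p ^+ (j + M + a * i) * q ^+ (b * (t - i) + M) = rho ^+ i * Y.
  rewrite /Y /X /rho expr_div_n -!exprM !exprD.
  have -> : (b * t = b * i + b * (t - i))%N by rewrite -mulnDr subnKC // ltnW.
  rewrite exprD; field.
  by rewrite !gt_eqF.
split; [by rewrite addnAC leq_addl|by rewrite leq_addl|rewrite E].
rewrite -ler_pdivlMr // il /=.
move: iu; rewrite ltr_pdivrMr // => iu; apply: lt_trans iu _.
by rewrite exprS -mulrA ltr_pM2r // mulr_gt0.
Qed.

(* Pigeonhole on the integer parts of [K * 3 ^ i / 2 ^ e i], which lie in
   [K, 2 K). *)
Lemma pow3_div_pow2_near1 (R : archiRealFieldType) (d : R) : 0 < d ->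
  exists a b : nat, 1 < (3 : R) ^+ b / 2 ^+ a < 1 + d \/
     1 < (2 : R) ^+ a / 3 ^+ b < 1 + d.
Proof.
move=> d0; pose K := (Num.bound d^-1).+1.
have Kd : K%:R^-1 < d.
  rewrite invf_plt ?posrE // ; apply: lt_trans (archi_boundP _) _.
    by rewrite invr_ge0 ltW.
  by rewrite ltr_nat.
pose e i := trunc_log 2 (3 ^ i).
have eP i : (2 ^ e i <= 3 ^ i < 2 ^ (e i).+1)%N.
  by apply: trunc_log_bounds; rewrite ?expn_gt0.
pose f i := (K * 3 ^ i %/ 2 ^ e i - K)%N.
have Kf i : (K <= K * 3 ^ i %/ 2 ^ e i)%N.
  by rewrite leq_divRL ?expn_gt0 // leq_mul2l; case/andP: (eP i) => ->; rewrite orbT.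
have fK i : (f i < K)%N.
  rewrite /f ltn_subLR // addnn -mul2n ltn_divLR ?expn_gt0 // mulnAC -expnS mulnC.
  by rewrite ltn_mul2r; case/andP: (eP i) => _ ->; rewrite andbT.
have [i [j [ij fij]]] : exists i j : nat, (i < j)%N /\ f i = f j.
  pose g (i : 'I_K.+1) := Ordinal (fK i).
  have /injectivePn[x [y xy gxy]] : ~~ injectiveb g.
    apply/negP => /injectiveP /leq_card; rewrite !card_ord; lia.
  have fxy : f x = f y by case: gxy.
  case: (ltngtP x y) => h; [by exists x, y|by exists y, x|].
  by move: xy; rewrite (ord_inj h) eqxx.
have {}fij : (K * 3 ^ i %/ 2 ^ e i = K * 3 ^ j %/ 2 ^ e j)%N.
  by have := Kf i; have := Kf j; move: fij; rewrite /f; lia.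
pose u (i : nat) : R := 3 ^+ i / 2 ^+ e i.
have K0 : 0 < K%:R :> R by rewrite ltr0n.
have u1 k : 1 <= u k.
  rewrite ler_pdivlMr ?exprn_gt0 // mul1r -!natrX ler_nat.
  by case/andP: (eP k).
have u0 k : 0 < u k by apply: lt_le_trans (u1 k).
(* Equal integer parts put [u k] and [u l] within [1 / K < d] of each other, and [d <= d * u l]
   because [u l >= 1]. *)
have close k l : (K * 3 ^ k %/ 2 ^ e k = K * 3 ^ l %/ 2 ^ e l)%N ->
    u k < (1 + d) * u l.
  move=> E; set Q := (K * 3 ^ k %/ 2 ^ e k)%N in E.
  have h1 : K%:R * u k < Q%:R + 1.
    rewrite mulrA ltr_pdivrMr ?exprn_gt0 // natr1 -!natrX -!natrM ltr_nat.
    by rewrite -ltn_divLR ?expn_gt0.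
  have h2 : Q%:R <= K%:R * u l.
    rewrite mulrA ler_pdivlMr ?exprn_gt0 // -!natrX -!natrM ler_nat E.
    exact: leq_divM.
  have : K%:R * u k < K%:R * u l + 1 by lra.
  rewrite -ltr_pdivlMl // mulrDr mulKf ?gt_eqF // mulr1 => h.
  apply: lt_le_trans h _; rewrite mulrDl mul1r lerD2l.
  apply: le_trans (ltW Kd) _; rewrite ler_peMr ?u1 // ltW //.
have ei : (e i <= e j)%N by apply: leq_trunc_log; rewrite leq_exp2l // ltnW.
exists (e j - e i)%N, (j - i)%N.
have E : u j / u i = 3 ^+ (j - i) / 2 ^+ (e j - e i).
  rewrite /u -{1}(subnKC (ltnW ij)) -{1}(subnKC ei) !exprD.
  by field; rewrite !expf_neq0.
have E' : u i / u j = 2 ^+ (e j - e i) / 3 ^+ (j - i).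
  by rewrite -[LHS]invf_div E invf_div.
rewrite -E -E'; move: (close i j fij) (close j i (esym fij)) (u0 i) (u0 j) E.
move=> {}close close' ui uj E.
case: (ltgtP (u i) (u j)) => h.
- by left; rewrite (ltr_pdivlMr _ _ ui) mul1r h (ltr_pdivrMr _ _ ui) close'.
- by right; rewrite (ltr_pdivlMr _ _ uj) mul1r h (ltr_pdivrMr _ _ uj) close.
(* Equality would make a power of 3 a power of 2; by parity both are 1, contradicting [i < j]. *)
have E1 : (3 ^ (j - i))%N = (2 ^ (e j - e i))%N.
  apply/eqP; rewrite -(eqr_nat R) !natrX.
  move: E; rewrite h (divff (lt0r_neq0 uj)) => /esym/divr1_eq ->; exact: eqxx.
have := congr1 odd E1; rewrite !oddX /= orbT; case: (e j - e i)%N E1 => [|//].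
by move=> /eqP; rewrite expn0 -[1%N](expn0 3) eqn_exp2l // subn_eq0 leqNgt ij.
Qed.

Lemma dense_pow2_pow3 (R : archiRealFieldType) (d : R) (M : nat) : 0 < d ->
  exists X : R, forall x, X <= x -> exists j l : nat,
  [/\ (M <= j)%N, (M <= l)%N
    & (2 ^ j * 3 ^ l)%:R <= x < (1 + d) * (2 ^ j * 3 ^ l)%:R].
Proof.
move=> d0; have p2 : 1 < 2 :> R by rewrite ltr1n.
have p3 : 1 < 3 :> R by rewrite ltr1n.
have [a [b [h|h]]] := pow3_div_pow2_near1 d0.
  have [X HX] := dense_of_ratio M p3 p2 h; exists X => x /HX [j [l [? ? ?]]].
  by exists l, j; split=> //; rewrite natrM !natrX mulrC.
have [X HX] := dense_of_ratio M p2 p3 h; exists X => x /HX [j [l [? ? ?]]].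
by exists j, l; split=> //; rewrite natrM !natrX.
Qed.

(** * Explicit systems: grids, projective planes, and a bound for every size *)

Lemma sum_indicator (R : pzSemiRingType) (T : finType) (P : pred T) :
  \sum_x (P x)%:R = #|P|%:R :> R.
Proof. by rewrite -natr_sum -big_mkcond sum1_card. Qed.

(** The set at [b] is the cross of the row and column through [b]. The ordered pair [(b, d)] gives
    its whole share to the corner [(b.1, d.2)], so each point serves [a ^ 2] of the [a ^ 4]
    pairs. *)
Lemma bis_le_grid (R : realType) (a : nat) : (0 < a)%N -> bis_le R (a * a) (a + a).
Proof.
move=> a0; exists ('I_a * 'I_a)%type; first by rewrite card_prod card_ord.
pose c : R := (a%:R * a%:R)^-1.
have aR : a%:R != 0 :> R by rewrite pnatr_eq0 -lt0n.
exists ('I_a * 'I_a)%type, (fun b => [set p | (p.1 == b.1) || (p.2 == b.2)]%SET),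
  (fun _ => c), (fun b d p => (p == (b.1, d.2))%:R); split.
- split=> [_|]; first by rewrite invr_ge0 mulr_ge0.
  by rewrite sumr_const card_prod card_ord -[LHS]mulr_natl natrM mulfV // mulf_neq0.
- split=> [*|b d]; first by rewrite ler0n.
  by rewrite sum_indicator card1.
- by move=> b d p; rewrite ltr0n lt0b => /eqP ->; rewrite !inE /= !eqxx orbT.
- move=> [x y].
  transitivity (\sum_(b : 'I_a * 'I_a) (b.1 == x)%:R * (c * c * a%:R)).
    apply: eq_bigr => b _; rewrite -mulr_sumr [RHS]mulrCA; congr (_ * _).
    transitivity (\sum_(d : 'I_a * 'I_a) ((b.1 == x) && (d.2 == y))%:R : R).
      by apply: eq_bigr => d _; rewrite xpair_eqE (eq_sym x) (eq_sym y).
    rewrite sum_indicator; case: (b.1 == x) => /=; last by rewrite mul0r eq_card0.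
    rewrite mul1r; congr _%:R.
    rewrite (_ : #|_| = #|finset.setX finset.setT [set y]%SET : {set 'I_a * 'I_a}|).
      by rewrite finset.cardsX cardsT cards1 card_ord muln1.
    by apply: eq_card => b'; rewrite !inE.
  rewrite -mulr_suml sum_indicator.
  have -> : #|[pred b : 'I_a * 'I_a | b.1 == x]| = a.
    rewrite (_ : #|_| = #|finset.setX [set x]%SET finset.setT : {set 'I_a * 'I_a}|).
      by rewrite finset.cardsX cardsT cards1 card_ord mul1n.
    by apply: eq_card => b; rewrite !inE andbT.
  rewrite card_prod card_ord natrM /c; field; exact: aR.
- move=> b; rewrite (_ : [set p | _] =
    finset.setX [set b.1] finset.setT :|: finset.setX finset.setT [set b.2])%SET.
    apply: leq_trans (leq_card_setU _ _) _.
    by rewrite !finset.cardsX !cardsT !cards1 card_ord mul1n muln1.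
  by apply/finset.setP => p; rewrite !inE andbT.
Qed.

(* The point [(Some x, y)] is the affine point [(x, y)] and [(None, a)] is the
   point at infinity of slope [a]; a line is the graph of [g l]. *)
Lemma bis_le_plane (R : realType) (K : finFieldType) :
  bis_le R (#|K|.+1 * #|K|) #|K|.+1.
Proof.
exists (option K * K)%type; first by rewrite card_prod card_option.
pose q : R := #|K|%:R.
have q0 : q != 0 by rewrite pnatr_eq0 -lt0n; apply/card_gt0P; exists 0.
have q1 : q + 1 != 0 by rewrite natr1.
pose g (l : K * K) (u : option K) := if u is Some x then l.1 * x + l.2 else l.1.
pose agree l m : {set option K} := [set u | g l u == g m u]%SET.
have agree_ll l : #|agree l l| = #|K|.+1.
  rewrite -card_option -cardsT; congr #|pred_of_set _|.
  by apply/finset.setP => u; rewrite !inE eqxx.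
(* Lines of equal slope meet only at infinity; the others meet at one affine point. *)
have agree_lm l m : l != m -> #|agree l m| = 1%N.
  case: l m => [a b] [a' b'] lm; have [aa|aa] := eqVneq a a'.
    apply/eqP/cards1P; exists None.
    apply/finset.setP => -[x|]; rewrite !inE /= aa ?eqxx //.
    rewrite (inj_eq (addrI _)); apply: contraNF lm => /eqP ->; by rewrite aa.
  apply/eqP/cards1P; exists (Some ((b' - b) / (a - a'))).
  apply/finset.setP => -[x|]; rewrite !inE /=; last exact/negbTE.
  have aa0 : a - a' != 0 by rewrite subr_eq0.
  rewrite -[RHS]/(x == _); apply/eqP/eqP => [e|->]; last by field.
  apply: (canRL (mulfK aa0)); apply: subr0_eq.
  transitivity ((a * x + b) - (a' * x + b')); first ring.
  by rewrite e subrr.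
have agree0 l m : (0 < #|agree l m|)%N.
  by have [->|/agree_lm ->] := eqVneq l m; rewrite ?agree_ll.
(* Lines have equal weights, and each pair spreads its share uniformly over its common points. *)
exists (K * K)%type, (fun l => [set p | g l p.1 == p.2]%SET),
  (fun _ => (q * q)^-1),
  (fun l m p => ((g l p.1 == p.2) && (g m p.1 == p.2))%:R / #|agree l m|%:R); split.
- split=> [_|]; first by rewrite invr_ge0 mulr_ge0.
  by rewrite sumr_const card_prod -[LHS]mulr_natl natrM mulfV // mulf_neq0.
- split=> [*|l m]; first by rewrite divr_ge0.
  rewrite -mulr_suml sum_indicator.
  rewrite [X in X%:R / _](_ : _ = #|agree l m|).
    by rewrite divff // pnatr_eq0 -lt0n.
  transitivity #|[set (u, g l u) | u in agree l m]%SET|; last first.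
    by apply: card_imset => u v [].
  apply: eq_card => -[u v]; rewrite unfold_in /=; apply/andP/imsetP => [[/eqP <- gm]|[x]].
    by exists u => //; rewrite inE eq_sym.
  by rewrite inE => e [-> ->]; rewrite eqxx eq_sym.
- by move=> l m p; rewrite !inE; case: (_ && _) => //; rewrite mul0r ltxx.
- move=> [u v] /=.
  pose S := [set l | g l u == v]%SET.
  have cardS : #|S| = #|K|.
    have [f fI fS] : exists2 f : K -> K * K,
        injective f & forall l, (l \in S) = (l \in codom f).
      rewrite /S {S}; case: u => [x|].
        exists (fun a => (a, v - a * x)) => [a a' [] //|[a b]]; rewrite inE /=.
        apply/eqP/codomP => [<-|[_ [<- ->]]]; last by rewrite addrC subrK.
        by exists a; rewrite addrC addKr.
      exists (fun b => (v, b)) => [a a' [] //|[a b]]; rewrite inE /=.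
      by apply/eqP/codomP => [->|[_ [<- _]] //]; exists b.
    by rewrite (eq_card fS) card_codom.
  (* For each of the [q] lines [l] through the point, [m = l] contributes [1 / (q + 1)] and each of
     the other [q - 1] lines contributes 1. Since [1 / (q + 1) + (q - 1) = q ^ 2 / (q + 1)], the
     total is [1 / (q * (q + 1))]. *)
  transitivity
    (\sum_(l in S) ((q * q)^-1 * (q * q)^-1 * ((q + 1)^-1 + (q - 1)))); last first.
    rewrite sumr_const cardS -mulr_natl card_prod card_option natrM -natr1 -/q.
    by field; rewrite q0.
  rewrite [RHS]big_mkcond /=; apply: eq_bigr => l _; rewrite inE -mulr_sumr.
  case: ifP => [lS|lS]; last by rewrite big1 ?mulr0 // => m _; rewrite mul0r.
  congr (_ * _); transitivity (\sum_(m in S) (#|agree l m|%:R^-1 : R)).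
    rewrite [RHS]big_mkcond /=; apply: eq_bigr => m _; rewrite inE /=.
    by case: (_ == _); rewrite ?mul1r ?mul0r.
  rewrite (bigD1 l) /=; last by rewrite inE lS.
  rewrite agree_ll -natr1; congr (_ + _).
  rewrite (eq_bigr (fun _ => 1)) => [|m /andP[_ ml]]; last first.
    by rewrite agree_lm ?invr1 // eq_sym.
  rewrite sumr_const (_ : #|_| = #|(S :\ l)%SET|); last first.
    by apply: eq_card => m; rewrite unfold_in /= !inE andbC.
  have := cardsD1 l S; rewrite inE lS cardS /= => e.
  by rewrite /q e natrD addrAC subrr add0r.
- move=> l; rewrite -card_option -cardsT.
  rewrite (_ : [set p | _]%SET = [set (u, g l u) | u in finset.setT]%SET).
    exact: leq_imset_card.
  apply/finset.setP => -[u v]; rewrite inE /=; apply/eqP/imsetP => [<-|[x _ [-> ->]] //].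
  by exists u.
Qed.

(** With [a] the integer part of the square root of [r], a grid takes [a * a] points at cost [2 a],
    and one single set takes the at most [2 a] points left over. *)
Lemma bis_le_sqrt (R : realType) (r : nat) : (0 < r)%N ->
  exists2 k, bis_le R r k & k%:R <= 4 * Num.sqrt (r%:R : R).
Proof.
move=> r0.
have ex : exists a, (a * a <= r)%N by exists 0%N.
have bnd a : (a * a <= r)%N -> (a <= r)%N by nia.
case: (ex_maxnP ex bnd) => a ar max.
have a0 : (0 < a)%N by exact: (max 1%N).
have ra : (r <= a * a + (a + a))%N.
  by rewrite leqNgt; apply/negP => h; have := max a.+1; nia.
have sa : a%:R <= Num.sqrt (r%:R : R).
  by rewrite -[leLHS]ger0_norm // -sqrtr_sqr ler_wsqrtr // expr2 -natrM ler_nat.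
exists (a + a + (a + a))%N; last by rewrite !natrD; lra.
have [e|n0] := posnP (r - a * a).
  have -> : r = (a * a)%N by lia.
  by apply: bis_leW (bis_le_grid R a0); lia.
have -> : r = (a * a + (r - a * a))%N by lia.
apply: bis_leW (bis_le_add _ (bis_le_grid R a0) (bis_le_trivial R n0)); lia.
Qed.

Lemma bis_le_prime_power (R : realType) (p k : nat) : prime p -> (0 < k)%N ->
  bis_le R ((p ^ k).+1 * p ^ k) (p ^ k).+1.
Proof.
by move=> pp k0; have [K _ <-] := pPrimePowerField pp k0; exact: bis_le_plane.
Qed.

(** * The lower bound *)

Lemma sqrt_le_cardinality (R : realType) (n k : nat) : has_bis R n k ->
  Num.sqrt (n%:R : R) <= k%:R.
Proof.
move=> [m [F [w [s [[w01 [w1 [s01 s1]]] [sF [sb <-]]]]]]].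
have w0 i : 0 <= w i by case/andP: (w01 i).
have [n0|n0] := posnP n.
  have -> : (n%:R : R) = 0 by rewrite n0.
  by rewrite sqrtr0.
have sq0 : 0 < Num.sqrt (n%:R : R) by rewrite sqrtr_gt0 ltr0n.
have sqn : Num.sqrt (n%:R : R) ^+ 2 = n%:R by rewrite sqr_sqrtr.
pose x (p : 'I_n) := \sum_i w i * (p \in F i)%:R.
have x0 p : 0 <= x p by apply: sumr_ge0 => i _; rewrite mulr_ge0.
(* The balance sum is at most [x p ^ 2] term by term: [s i j p] is at most 1, and is 0 unless [p]
   lies in both [F i] and [F j]. *)
have x_ge p : (Num.sqrt n%:R)^-1 <= x p.
  rewrite -(@ler_pXn2r _ 2) ?nnegrE ?invr_ge0 ?sqrtr_ge0 // exprVn sqn.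
  rewrite -div1r -(sb p) expr2 /x mulr_suml ler_sum // => i _.
  rewrite mulr_sumr ler_sum // => j _.
  rewrite mulrACA -mulrA -[leRHS]mulrA ler_wpM2l // ler_wpM2l //.
  have /andP[sij0 sij1] := s01 i j p.
  have [s0|] := eqVneq (s i j p) 0; first by rewrite s0 mulr_ge0.
  rewrite neq_lt ltNge sij0 /= => /sF; rewrite inE => /andP[-> ->].
  by rewrite mulr1.
have : \sum_(p < n) (Num.sqrt n%:R)^-1 <= (cardinality F)%:R :> R.
  apply: (@le_trans _ _ (\sum_p x p)); first by apply: ler_sum.
  have -> : (cardinality F)%:R = \sum_i w i * (cardinality F)%:R.
    by rewrite -mulr_suml w1 mul1r.
  rewrite exchange_big /= ler_sum // => i _.
  rewrite -mulr_sumr ler_wpM2l //; rewrite sum_indicator ler_nat.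
  exact: (leq_bigmax (F := fun i => #|F i|)).
by rewrite sumr_const card_ord -[X in X <= _]mulr_natl -{1}sqn expr2 mulfK // gt_eqF.
Qed.

Lemma sqrt_le_kfun (R : realType) (n : nat) : (0 < n)%N ->
  Num.sqrt (n%:R : R) <= (kfun R n)%:R.
Proof.
move=> n0; rewrite /kfun; case: pselect => [h|nh].
  by case: ex_minnP => k /asboolP /sqrt_le_cardinality.
(* The trivial system rules out the default value 0 of [kfun]. *)
by have [k hk _] := has_bis_of_le (bis_le_trivial R n0); case: nh; exists k.
Qed.

(** * The asymptotic upper bound and the limit *)

Local Open Scope classical_set_scope.

(** With [d = h ^ 2], the product system costs at most [(1 + d) * sqrt n] and leaves at most
    [4 * d * n] points. By [bis_le_sqrt] these cost at most [4 * (2 * h * sqrt n)], and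
    [d + 8 * h <= 9 * h]. *)
Lemma kfun_upper (R : realType) (h : R) : 0 < h <= 1 ->
  \forall n \near \oo, (kfun R n)%:R <= (1 + 9 * h) * Num.sqrt (n%:R : R).
Proof.
move=> /andP[h0 h1]; pose d := h ^+ 2.
have d0 : 0 < d by rewrite exprn_gt0.
have d1 : d <= 1 by rewrite /d expr_le1 // ltW.
have dh : d <= h by rewrite /d expr2 ler_piMl // ltW.
(* From [M] on, passing from [q] to [q + 1] costs at most a factor [1 + d]. *)
pose M := (Num.bound d^-1).+1.
have Md (q : nat) : (M <= q)%N -> q%:R + 1 <= (1 + d) * q%:R.
  move=> Mq; rewrite mulrDl mul1r lerD2l -ler_pdivrMl // mulr1.
  apply: le_trans (ltW (archi_boundP _)) _; first by rewrite invr_ge0 ltW.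
  by rewrite ler_nat ltnW.
have [X HX] := dense_pow2_pow3 M d0.
near=> n.
have n0 : (0 < n)%N by near: n; exact: nbhs_infty_gt.
set sn := Num.sqrt n%:R.
have sn0 : 0 < sn by rewrite sqrtr_gt0 ltr0n.
have snn : sn ^+ 2 = n%:R by rewrite sqr_sqrtr.
have d10 : 0 < 1 + d by rewrite addr_gt0.
(* Aiming at [sn / (1 + d)] rather than [sn] leaves room for the two factors [(q + 1) / q] in [N],
   so that [N <= n]. *)
have /HX [j [l [Mj Ml]]] : X <= sn / (1 + d).
  rewrite ler_pdivlMr //.
  have nX : (`|X * (1 + d)|) ^+ 2 <= n%:R.
    near: n; exact: nbhs_infty_ger.
  apply: le_trans (ler_norm _) _.
  by rewrite -[leLHS]ger0_norm // -sqrtr_sqr ler_wsqrtr.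
set q1 := (2 ^ j)%N; set q2 := (3 ^ l)%N; rewrite natrM.
rewrite ler_pdivlMr // ltr_pdivrMr // => /andP[Qle Qgt].
have q1M : (M <= q1)%N by apply: leq_trans Mj (ltnW (ltn_expl _ _)).
have q2M : (M <= q2)%N by apply: leq_trans Ml (ltnW (ltn_expl _ _)).
have j0 : (0 < j)%N by apply: leq_trans Mj.
have l0 : (0 < l)%N by apply: leq_trans Ml.
have q10 : 0 < q1%:R :> R by rewrite ltr0n expn_gt0.
have q20 : 0 < q2%:R :> R by rewrite ltr0n expn_gt0.
pose N := (q1.+1 * q1 * (q2.+1 * q2))%N.
have bN : bis_le R N (q1.+1 * q2.+1).
  by apply: bis_le_mul; apply: bis_le_prime_power.
set Q := q1%:R * q2%:R in Qle Qgt.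
have Q0 : 0 < Q by rewrite mulr_gt0.
have cQ : (q1.+1 * q2.+1)%:R <= (1 + d) ^+ 2 * Q :> R.
  rewrite natrM -!(natr1 _).
  have -> : (1 + d) ^+ 2 * Q = ((1 + d) * q1%:R) * ((1 + d) * q2%:R) by rewrite /Q; ring.
  by rewrite ler_pM ?addr_ge0 ?Md.
have NQ : N%:R = (q1.+1 * q2.+1)%:R * Q :> R by rewrite /N /Q !natrM; ring.
have Nn : (N <= n)%N.
  rewrite -(ler_nat R) NQ -snn.
  have : (q1.+1 * q2.+1)%:R * Q <= (1 + d) ^+ 2 * Q * Q by rewrite ler_pM2r.
  have : (Q * (1 + d)) ^+ 2 <= sn ^+ 2 by rewrite ler_pXn2r ?nnegrE ?mulr_ge0 // ltW.
  nra.
have kQ : (q1.+1 * q2.+1)%:R <= (1 + d) * sn.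
  apply: le_trans cQ _; rewrite expr2 -mulrA ler_pM2l //; lra.
have QN : Q ^+ 2 <= N%:R.
  by rewrite NQ expr2 ler_pM2r // /Q -natrM ler_nat leq_mul.
have nN : (n - N)%:R <= (2 * h * sn) ^+ 2.
  have -> : (2 * h * sn) ^+ 2 = 4 * d * n%:R by rewrite -snn /d; ring.
  rewrite natrB // lerBlDl -lerBlDr; apply: le_trans QN.
  (* If [d > 1 / 2] then [4 * d * n] already exceeds [n]. Otherwise [(1 - 2 * d) * (1 + d) ^ 2 = 1 -
     d ^ 2 * (3 + 2 * d) <= 1] gives [(1 - 2 * d) * sn <= Q], and squaring yields
     [(1 - 4 * d) * n <= Q ^ 2]. *)
  have [d2|d2] := lerP 0 (1 - 2 * d); last first.
    have : 0 <= Q ^+ 2 by rewrite sqr_ge0.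
    have : 0 <= (4 * d - 1) * n%:R by rewrite mulr_ge0 //; lra.
    lra.
  have Qsn : (1 - 2 * d) * sn <= Q.
    have : (1 - 2 * d) * sn <= (1 - 2 * d) * ((1 + d) * Q * (1 + d)).
      by rewrite ler_wpM2l // ltW.
    have : 0 <= d ^+ 2 * (3 + 2 * d) * Q.
      by rewrite !mulr_ge0 ?sqr_ge0 ?addr_ge0 ?mulr_ge0 // ltW.
    lra.
  have : ((1 - 2 * d) * sn) ^+ 2 <= Q ^+ 2.
    by rewrite ler_pXn2r ?nnegrE ?mulr_ge0 // ltW.
  rewrite exprMn snn; have : 0 <= d ^+ 2 * n%:R by rewrite mulr_ge0 ?sqr_ge0.
  lra.
suff [k bk kle] : exists2 k, bis_le R n k & k%:R <= (1 + 9 * h) * sn.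
  by apply: le_trans kle; rewrite ler_nat kfun_le.
have [e|r0] := posnP (n - N).
  exists (q1.+1 * q2.+1)%N.
    by have -> : n = N by apply/eqP; rewrite eqn_leq Nn andbT -subn_eq0 e.
  by apply: le_trans kQ _; rewrite ler_pM2r //; lra.
have [k bk kle] := bis_le_sqrt R r0.
exists (q1.+1 * q2.+1 + k)%N.
  by rewrite -(subnKC Nn); apply: bis_le_add => //; rewrite subnKC.
have : Num.sqrt (n - N)%:R <= 2 * h * sn :> R.
  have -> : 2 * h * sn = Num.sqrt ((2 * h * sn) ^+ 2).
    by rewrite sqrtr_sqr ger0_norm // !mulr_ge0 // ltW.
  exact: ler_wsqrtr.
have : d * sn <= h * sn by rewrite ler_pM2r.
rewrite natrD; lra.
Unshelve. all: by end_near.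
Qed.

(* k(n) = sqrt(n) (1 + o(1)), i.e. k(n) / sqrt(n) -> 1 as n -> oo. *)
Theorem theorem3 (R : realType) :
  ((kfun R n)%:R / Num.sqrt (n%:R : R)) @[n --> \oo] --> (1 : R).
Proof.
apply/cvgrPdist_le => e e0.
pose h := Num.min (e / 9) 1.
have h0 : 0 < h by rewrite lt_min divr_gt0 // ltr01.
have h1 : h <= 1 by rewrite ge_min lexx orbT.
have he : 9 * h <= e by rewrite -ler_pdivlMl // mulrC ge_min lexx.
have := @kfun_upper R h; rewrite h0 h1 => /(_ isT) up.
near=> n.
have n0 : (0 < n)%N by near: n; exact: nbhs_infty_gt.
have sn0 : 0 < Num.sqrt (n%:R : R) by rewrite sqrtr_gt0 ltr0n.
have lo : 1 <= (kfun R n)%:R / Num.sqrt (n%:R : R).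
  by rewrite ler_pdivlMr // mul1r sqrt_le_kfun.
have hi : (kfun R n)%:R / Num.sqrt (n%:R : R) <= 1 + 9 * h.
  by rewrite ler_pdivrMr //; near: n.
rewrite distrC ger0_norm ?subr_ge0 //; lra.
Unshelve. all: by end_near.
Qed.
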